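(* For every cake-division instance with $n$ agents whose social graph is a tree of depth at most two, there exists a discrete protocol in the Robertson–Webb query model that finds a locally envy-free allocation using at most $O(n^3\log n)$ cut queries and $O(n^4\log n)$ evaluation queries.
   Context: The cake is $[0,1]$. Each agent $a_i$ has a valuation $v_i$ on finite unions of subintervals of $[0,1]$ that is non-negative, additive on disjoint pieces, non-atomic (for any $[x,y]$ and $\lambda\in[0,1]$ there is $y'$ with $v_i(x,y')=\lambda v_i(x,y)$), and normalized ($v_i(0,1)=1$). An allocation is a collection $\{A_1,\dots,A_n\}$ of pairwise disjoint pieces (each a finite union of intervals) whose union is $[0,1]$, with $A_i$ given to $a_i$. Given an undirected social graph $G$ on the agents, an allocation is locally envy-free if $v_i(A_i)\ge v_i(A_j)$ for every edge $(i,j)$ of $G$. In the Robertson–Webb query model the protocol accesses valuations only through cut queries $\texttt{cut}_i(x,\tau)$ (returns $y$ with $v_i(x,y)=\tau$) and evaluation queries $\texttt{eval}_i(x,y)$ (returns $v_i(x,y)$). A tree of depth at most two is a tree with a root such that every vertex is at distance at most two from the root. *)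

(* Defs.v *)
From mathcomp Require Import all_boot.
From Stdlib Require Import Reals.
Set Implicit Arguments. Unset Strict Implicit. Unset Printing Implicit Defensive.

Local Open Scope R_scope.

(** Interval valuation: [v x y] is the value of [x,y] (for 0 <= x <= y <= 1). *)
Definition interval_valuation := R -> R -> R.

Definition is_valuation (v : interval_valuation) : Prop :=
  (forall x y, 0 <= x -> x <= y -> y <= 1 -> 0 <= v x y) /\
  (forall x y z, 0 <= x -> x <= y -> y <= z -> z <= 1 -> v x z = v x y + v y z) /\
  (forall x y lam, 0 <= x -> x <= y -> y <= 1 -> 0 <= lam -> lam <= 1 ->
     exists y', x <= y' /\ y' <= y /\ v x y' = lam * v x y) /\
  v 0 1 = 1.

(** A piece: a finite union of subintervals [a,b], given as a list of pairs. *)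
Definition piece := seq (R * R).

Definition piece_value (v : interval_valuation) (p : piece) : R :=
  foldr (fun ab acc => v ab.1 ab.2 + acc) 0 p.

Definition nth_int (p : piece) (k : nat) : R * R := nth (0, 0) p k.

(** An allocation: pieces of well-formed subintervals of [0,1], with pairwise
    disjoint interiors (endpoints have value 0 by non-atomicity), covering [0,1]. *)
Definition is_allocation (n : nat) (A : 'I_n -> piece) : Prop :=
  (forall (i : 'I_n) (k : nat), (k < size (A i))%nat ->
     0 <= (nth_int (A i) k).1 /\ (nth_int (A i) k).1 <= (nth_int (A i) k).2 /\
     (nth_int (A i) k).2 <= 1) /\
  (forall (i j : 'I_n) (k l : nat), (k < size (A i))%nat -> (l < size (A j))%nat -> (i, k) <> (j, l) ->
     Rmin (nth_int (A i) k).2 (nth_int (A j) l).2 <=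
     Rmax (nth_int (A i) k).1 (nth_int (A j) l).1) /\
  (forall t, 0 <= t -> t <= 1 ->
     exists (i : 'I_n) (k : nat), (k < size (A i))%nat /\ (nth_int (A i) k).1 <= t /\ t <= (nth_int (A i) k).2).

Definition locally_envy_free (n : nat) (G : rel 'I_n) (v : 'I_n -> interval_valuation)
    (A : 'I_n -> piece) : Prop :=
  forall i j, G i j -> piece_value (v i) (A j) <= piece_value (v i) (A i).

Definition simple_graph (n : nat) (G : rel 'I_n) : Prop :=
  symmetric G /\ irreflexive G.

Definition graph_connected (n : nat) (G : rel 'I_n) : Prop :=
  forall x y, connect G x y.

Definition graph_acyclic (n : nat) (G : rel 'I_n) : Prop :=
  forall (x : 'I_n) (p : seq 'I_n),
    path G x p -> uniq (x :: p) -> (2 <= size p)%nat -> ~~ G (last x p) x.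

Definition is_tree (n : nat) (G : rel 'I_n) : Prop :=
  simple_graph G /\ graph_connected G /\ graph_acyclic G.

Definition tree_depth_le2 (n : nat) (G : rel 'I_n) : Prop :=
  is_tree G /\
  exists r : 'I_n, forall u : 'I_n, u = r \/ G r u \/ exists w, G r w /\ G w u.

(** Discrete protocols in the Robertson–Webb model: query trees; the
    continuation receives the answer of the query. Arguments of queries may be
    computed arbitrarily from previous answers. *)
Inductive protocol (n : nat) : Type :=
| Output : ('I_n -> piece) -> protocol n
| CutQ : 'I_n -> R -> R -> (R -> protocol n) -> protocol n
| EvalQ : 'I_n -> R -> R -> (R -> protocol n) -> protocol n.

(** [succeeds G v P c e]: run against valuations v, for EVERY admissible answer
    to cut queries (any y with v_i(x,y) = tau), the protocol makes only
    well-posed queries, uses at most c cut and e evaluation queries, and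
    outputs a locally envy-free allocation. *)
Fixpoint succeeds (n : nat) (G : rel 'I_n) (v : 'I_n -> interval_valuation)
    (P : protocol n) (c e : nat) {struct P} : Prop :=
  match P with
  | Output A => is_allocation A /\ locally_envy_free G v A
  | CutQ i x tau k =>
      (0 < c)%nat /\ 0 <= x /\ x <= 1 /\
      (exists y, x <= y /\ y <= 1 /\ v i x y = tau) /\
      (forall y, x <= y -> y <= 1 -> v i x y = tau -> succeeds G v (k y) c.-1 e)
  | EvalQ i x y k =>
      (0 < e)%nat /\ 0 <= x /\ x <= y /\ y <= 1 /\
      succeeds G v (k (v i x y)) c e.-1
  end.

(* Main.v *)
(** Call the neighbours of the root [r] centres and the other non-root agents
    leaves; a group is a centre together with its leaves.

    One round on a residue of the cake: [r] cuts it into [n] parts of equal value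
    and each group takes as many parts as it has members, all of them at least as
    good for its centre as the part left to [r]. The centre then trims these parts
    to a common value, and the trimmings form the next residue. Inside a group the
    trimmed parts can be permuted at will without hurting the centre or the root,
    and leaves choosing first do not envy their centre. For [r] the residue
    shrinks by a factor [1 - 1/n] per round, hence by a factor [n + 1] in [n^2]
    rounds.

    If [r] prefers its share to that of some centre [k] by more than a residue,
    that residue can be divided among the group of [k] alone, and we are done. To
    create such an advantage, [k] must end up with a heavily trimmed part [s] in
    some round. This can cost leaves of [k] something, but there is a
    welfare-maximizing way of forcing [s] on [k] whose cost for each leaf is at
    most the gain that leaf can be granted by another permutation of the same
    round. After [n^2 + 1] rounds some [k] has more than [n] rounds in which the
    most trimmed part is in its group; each leaf gets the one of these where its
    cost is maximal, and [s] is forced on [k] in a remaining one.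

    Each cut is followed by [n] evaluations, after which the values of all pieces
    for all agents are known again; so it suffices to count cuts. *)
Require Import Defs.
From HB Require Import structures.
From mathcomp Require Import all_boot all_fingroup zify.
From Stdlib Require Import Reals Lra Permutation ClassicalEpsilon FunctionalExtensionality.
Set Implicit Arguments.
Unset Strict Implicit.
Local Open Scope R_scope.

(** * The cutting game *)

Section Game.
Variable n : nat.

Definition vec := 'I_n -> R.
Definition vadd (u w : vec) : vec := fun i => u i + w i.
Definition nneg (u : vec) : Prop := forall i, 0 <= u i.

(* A position is the list of pieces the cake is currently cut into, each piece
   being represented by the vector of its values; after a cut at value [tau]
   for agent [i], the values of the two parts for the other agents are chosen
   adversarially. *)
Inductive win (Phi : seq vec -> Prop) : nat -> seq vec -> Prop :=
| WinDone m K : Phi K -> win Phi m K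
| WinPerm m K K' : Permutation K K' -> win Phi m K' -> win Phi m K
| WinZero m K : win Phi m ((fun _ => 0) :: K) -> win Phi m K
| WinMerge m u w K : win Phi m (vadd u w :: K) -> win Phi m [:: u, w & K]
| WinCut m i tau u K : 0 <= tau -> tau <= u i ->
    (forall u1 u2, nneg u1 -> nneg u2 -> (forall j, u1 j + u2 j = u j) ->
       u1 i = tau -> win Phi m [:: u1, u2 & K]) ->
    win Phi m.+1 (u :: K).

Lemma win_le Phi (m m' : nat) K : (m <= m')%nat -> win Phi m K -> win Phi m' K.
Proof.
move=> + w; elim: w m' => {m K}.
- by move=> m K H m' _; apply: WinDone.
- by move=> m K K' p _ IH m' le; apply: WinPerm p (IH _ le).
- by move=> m K _ IH m' le; apply: WinZero (IH _ le).
- by move=> m u w K _ IH m' le; apply: WinMerge (IH _ le).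
- move=> m i tau u K h0 h1 _ IH [|m'] // le.
  by apply: (@WinCut Phi m' i tau) => // u1 u2 p1 p2 e1 e2; apply: IH.
Qed.

Lemma win_bind Phi Psi (m m' : nat) K :
  win Phi m K -> (forall K', Phi K' -> win Psi m' K') -> win Psi (m + m') K.
Proof.
move=> w H; elim: w => {m K}.
- by move=> m K /H; apply: win_le; apply: leq_addl.
- by move=> m K K' p _ IH; apply: WinPerm p IH.
- by move=> m K _ IH; apply: WinZero.
- by move=> m u w K _ IH; apply: WinMerge.
- move=> m i tau u K h0 h1 _ IH.
  by rewrite addSn; apply: (@WinCut Psi (m + m') i tau) => // u1 u2 p1 p2 e1 e2; apply: IH.
Qed.

(** * Tilings of the cake by intervals with recorded values *)

Definition atom : Type := (R * R * vec)%type.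
Definition lo (a : atom) : R := a.1.1.
Definition hi (a : atom) : R := a.1.2.

(** In this form, shared with [is_allocation], a degenerate interval is compatible with every other
    one, so cuts at an endpoint are harmless. *)
Definition interior_disjoint (a b : atom) : Prop :=
  Rmin (hi a) (hi b) <= Rmax (lo a) (lo b).

Definition tiling (F : seq atom) : Prop :=
  [/\ forall a, List.In a F -> [/\ 0 <= lo a, lo a <= hi a & hi a <= 1],
      List.ForallOrdPairs interior_disjoint F
    & forall t, 0 <= t -> t <= 1 -> exists2 a, List.In a F & lo a <= t <= hi a].

Definition known (v : 'I_n -> interval_valuation) (F : seq atom) : Prop :=
  forall a, List.In a F -> forall i, a.2 i = v i (lo a) (hi a).

Definition total (d : seq atom) : vec :=
  fun i => foldr (fun a acc => a.2 i + acc) 0 d.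

Lemma total_cons a d i : total (a :: d) i = a.2 i + total d i.
Proof. by []. Qed.

Lemma total_cat d1 d2 i : total (d1 ++ d2) i = total d1 i + total d2 i.
Proof. rewrite /total; elim: d1 => [|a d1 IH] /=; [lra | rewrite IH; lra]. Qed.

Lemma interior_disjointC a b : interior_disjoint a b -> interior_disjoint b a.
Proof. by rewrite /interior_disjoint Rmin_comm Rmax_comm. Qed.

Lemma FOP_perm (T : Type) (r : T -> T -> Prop) (s s' : seq T) :
  (forall a b, r a b -> r b a) -> Permutation s s' ->
  List.ForallOrdPairs r s -> List.ForallOrdPairs r s'.
Proof.
move=> rC; elim=> {s s'} //.
- move=> a s s' p IH H; inversion H; subst; constructor; last exact: IH.
  by apply: Permutation_Forall; first exact: p.
- move=> a b s H; inversion H as [|? ? H1 H2]; subst.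
  inversion H2 as [|? ? H3 H4]; subst; inversion H1; subst.
  by constructor; [constructor; first exact: rC | constructor].
- by move=> s1 s2 s3 _ IH1 _ IH2 /IH1 /IH2.
Qed.

Lemma tiling_perm F F' : Permutation F F' -> tiling F -> tiling F'.
Proof.
move=> p [wf dj cov]; split.
- by move=> a /(Permutation_in _ (Permutation_sym p)); apply: wf.
- exact: FOP_perm interior_disjointC p dj.
- move=> t t0 t1; have [a aF h] := cov t t0 t1.
  by exists a => //; apply: Permutation_in aF.
Qed.

Lemma known_perm v F F' : Permutation F F' -> known v F -> known v F'.
Proof. by move=> p H a /(Permutation_in _ (Permutation_sym p)); apply: H. Qed.

Lemma flatten_perm (T : Type) (D D' : seq (seq T)) :
  Permutation D D' -> Permutation (flatten D) (flatten D').
Proof.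
elim=> {D D'} //=.
- by move=> a s s' _ IH; apply: Permutation_app_head.
- move=> a b s; rewrite !catA; apply: Permutation_app_tail; exact: Permutation_app_comm.
- by move=> s1 s2 s3 _ IH1 _ IH2; apply: Permutation_trans IH1 IH2.
Qed.

Lemma tiling_split a z w1 w2 L : lo a <= z <= hi a ->
  tiling (a :: L) -> tiling [:: (lo a, z, w1), (z, hi a, w2) & L].
Proof.
move=> hz [wf dj cov].
have [a0 aa a1] := wf a (or_introl erefl).
inversion dj as [|? ? dj1 dj2]; subst.
have sub (c : atom) : lo a <= lo c -> lo c <= hi c -> hi c <= hi a ->
    List.Forall (interior_disjoint c) L.
  move=> h1 h2 h3; apply/List.Forall_forall => b bL.
  have := (proj1 (List.Forall_forall _ _) dj1) b bL.
  have [_ bb _] := wf b (or_intror bL).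
  rewrite /interior_disjoint /Rmin /Rmax; do ![case: Rle_dec]; lra.
split.
- move=> b /= [<-|[<-|bL]]; rewrite /lo /hi /= in a0 aa a1 hz *; try by split; lra.
  by apply: wf; right.
- constructor; last constructor => //.
    constructor.
      rewrite /interior_disjoint /Rmin /Rmax /lo /hi /= in a0 aa a1 hz *.
      by do ![case: Rle_dec]; lra.
    by apply: sub; rewrite /lo /hi /= in a0 aa a1 hz *; lra.
  by apply: sub; rewrite /lo /hi /= in a0 aa a1 hz *; lra.
- move=> t t0 t1; have [b bL h] := cov t t0 t1.
  case: bL => [eb|bL]; last by exists b => //; right; right.
  subst b; case: (Rle_lt_dec t z) => tz.
    by exists (lo a, z, w1); [left|rewrite /lo /hi /= in h *; lra].
  by exists (z, hi a, w2); [right; left|rewrite /lo /hi /= in h *; lra].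
Qed.

Lemma known_split v a z w1 w2 L :
  (forall j, w1 j = v j (lo a) z) -> (forall j, w2 j = v j z (hi a)) ->
  known v (a :: L) -> known v [:: (lo a, z, w1), (z, hi a, w2) & L].
Proof.
move=> h1 h2 kn b /= [<-|[<-|bL]] i; [exact: h1|exact: h2|].
by apply: kn; right.
Qed.

Lemma total_ge0 v F :
  (forall i, is_valuation (v i)) -> known v F ->
  (forall a, List.In a F -> [/\ 0 <= lo a, lo a <= hi a & hi a <= 1]) ->
  nneg (total F).
Proof.
move=> hv kn wf i; elim: F kn wf => [|a F IH] kn wf; first by rewrite /total /=; lra.
have [a0 aa a1] := wf a (or_introl erefl).
have := (hv i).1 _ _ a0 aa a1; rewrite -kn; last by left.
have : 0 <= total F i by apply: IH => b bF; [apply: kn|apply: wf]; right.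
by rewrite total_cons; lra.
Qed.

(** A piece is a list of intervals, so cutting it at [tau] means cutting inside one atom, at [tau]
    minus the value of the atoms before it. *)
Lemma total_locate d i tau : d <> [::] -> 0 <= tau <= total d i ->
  exists d1 a d2, d = d1 ++ a :: d2 /\ 0 <= tau - total d1 i <= a.2 i.
Proof.
have t0 : total [::] i = 0 by [].
elim: d tau => [//|a d IH] tau _; rewrite total_cons => h.
case: (Rle_lt_dec tau (a.2 i)) => ta.
  by exists [::], a, d; rewrite t0; split=> //; lra.
have dn : d <> [::] by move=> d0; subst d; rewrite t0 in h; lra.
have [|d1 [b [d2 [-> h']]]] := IH (tau - a.2 i) dn; first lra.
by exists (a :: d1), b, d2; split=> //; rewrite total_cons; lra.
Qed.

(** * Translating wins in the game into query protocols *)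

Fixpoint eval_all (s : seq 'I_n) x y (acc : vec) (k : vec -> protocol n) : protocol n :=
  if s is i :: s' then
    EvalQ i x y (fun z => eval_all s' x y (fun j => if j == i then z else acc j) k)
  else k acc.

Lemma eval_allP G v s x y acc k (c e : nat) : 0 <= x -> x <= y -> y <= 1 ->
  succeeds G v (k (fun j => if j \in s then v j x y else acc j)) c e ->
  succeeds G v (eval_all s x y acc k) c (size s + e).
Proof.
move=> x0 xy y1; elim: s acc => [|i s IH] acc H //=.
do 4!split=> //; apply: IH.
set f := (f in k f); set g := (g in k g) in H.
suff -> : f = g by [].
apply: functional_extensionality => j; rewrite /f /g inE.
by case: eqP => [->|] //=; case: ifP.
Qed.

Lemma succeeds_le G v (P : protocol n) (c c' e e' : nat) : (c <= c')%nat -> (e <= e')%nat ->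
  succeeds G v P c e -> succeeds G v P c' e'.
Proof.
elim: P c c' e e' => [A|i x tau k IH|i x y k IH] c c' e e' lec lee //=.
- move=> [c0 [x0 [x1 [ex H]]]]; (split; first by lia); do 3!split=> //.
  by move=> y xy y1 vy; apply: IH (H y xy y1 vy) => //; lia.
- move=> [e0 [x0 [xy [y1 H]]]]; (split; first by lia); do 3!split=> //.
  by apply: IH H => //; lia.
Qed.

Definition final (G : rel 'I_n) (K : seq vec) : Prop :=
  exists2 B : 'I_n -> vec, K = map B (enum 'I_n) & forall i j, G i j -> B j i <= B i i.

Lemma FOP_cat (T : Type) (r : T -> T -> Prop) (s s' : seq T) :
  List.ForallOrdPairs r (s ++ s') ->
  [/\ List.ForallOrdPairs r s, List.ForallOrdPairs r s' &
      forall a b, List.In a s -> List.In b s' -> r a b].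
Proof.
elim: s => [|a s IH] /= H; first by split=> //; constructor.
inversion H as [|? ? H1 H2]; subst.
have [h1 h2 h3] := IH H2; have H1' := proj1 (List.Forall_forall _ _) H1.
split=> // [|x b [<-|xs] bs'].
- constructor=> //; apply/List.Forall_forall => b bs.
  by apply: H1'; apply/List.in_or_app; left.
- by apply: H1'; apply/List.in_or_app; right.
- exact: h3.
Qed.

Lemma In_nth (T : Type) (x0 : T) s k : (k < size s)%nat -> List.In (nth x0 s k) s.
Proof. by elim: s k => [|a s IH] [|k] //= h; [left|right; apply: IH]. Qed.

Lemma FOP_nth (T : Type) (x0 : T) (r : T -> T -> Prop) (s : seq T) k l :
  List.ForallOrdPairs r s -> (k < l)%nat -> (l < size s)%nat -> r (nth x0 s k) (nth x0 s l).
Proof.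
move=> H; elim: H k l => {s} [|a s H _ IH] [|k] [|l] //= kl ls; last exact: IH.
by apply: (proj1 (List.Forall_forall _ _) H); apply: In_nth.
Qed.

Lemma In_flatten (T : Type) (D : seq (seq T)) d a :
  List.In d D -> List.In a d -> List.In a (flatten D).
Proof.
elim: D => //= d' D IH [<-|dD] ad; apply/List.in_or_app; first by left.
by right; apply: IH.
Qed.

Lemma FOP_flatten (T : Type) (r : T -> T -> Prop) (D : seq (seq T)) (i j : nat) a b :
  List.ForallOrdPairs r (flatten D) -> (i < j)%nat ->
  List.In a (nth [::] D i) -> List.In b (nth [::] D j) -> r a b.
Proof.
elim: D i j => [|d D IH] [|i] [|j] //= /FOP_cat [_ H H2] ij ad bd; last exact: IH H _ ad bd.
apply: H2 => //; apply: (In_flatten _ bd).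
by apply: In_nth; rewrite ltnNge; apply/negP => le; move: bd; rewrite nth_default.
Qed.

Lemma In_nthP (T : Type) (x0 : T) s a :
  List.In a s -> exists2 k, (k < size s)%nat & nth x0 s k = a.
Proof.
elim: s => //= b s IH [->|/IH [k ks <-]]; first by exists 0%nat.
by exists k.+1.
Qed.

Lemma In_flattenP (T : Type) (D : seq (seq T)) a :
  List.In a (flatten D) -> exists2 i, (i < size D)%nat & List.In a (nth [::] D i).
Proof.
elim: D => //= d D IH /(List.in_app_or _ _ _) [ad|/IH [i iD ai]]; first by exists 0%nat.
by exists i.+1.
Qed.

Lemma succeeds_output (G : rel 'I_n) v D : map total D = map (fun i => total (nth [::] D (nat_of_ord i))) (enum 'I_n) ->
  (forall i j, G i j -> total (nth [::] D (nat_of_ord j)) i <= total (nth [::] D (nat_of_ord i)) i) ->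
  tiling (flatten D) -> known v (flatten D) ->
  forall c e, succeeds G v (Output (fun i : 'I_n => [seq a.1 | a <- nth [::] D (nat_of_ord i)])) c e.
Proof.
move=> eD noenvy [wf dj cov] kn c e.
have sD : size D = n by move: (congr1 size eD); rewrite 2!size_map size_enum_ord.
pose a0 : atom := (0, 0, fun => 0).
have nthE (i : nat) k : (k < size [seq a.1 | a <- nth [::] D i])%nat ->
    nth_int [seq a.1 | a <- nth [::] D i] k = (nth a0 (nth [::] D i) k).1.
  by rewrite size_map => h; rewrite /nth_int (nth_map a0).
have inF (i : 'I_n) a : List.In a (nth [::] D (nat_of_ord i)) -> List.In a (flatten D).
  by apply: In_flatten; apply: In_nth; rewrite sD.
have inN (i : 'I_n) k : (k < size [seq a.1 | a <- nth [::] D (nat_of_ord i)])%nat ->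
    List.In (nth a0 (nth [::] D (nat_of_ord i)) k) (nth [::] D (nat_of_ord i)).
  by rewrite size_map; apply: In_nth.
split; first split; last first.
- move=> i j Gij.
  have val (j' : 'I_n) : piece_value (v i) [seq a.1 | a <- nth [::] D (nat_of_ord j')] =
      total (nth [::] D (nat_of_ord j')) i.
    move: (inF j'); rewrite /piece_value /total.
    elim: (nth _ _ _) => //= a d IH H; rewrite IH; last by move=> b bd; apply: H; right.
    by rewrite [a.2 i]kn //; apply: H; left.
  by rewrite !val; apply: noenvy.
- split; last first.
    move=> t t0 t1; have [a aF h] := cov t t0 t1; have [i iD ai] := In_flattenP aF.
    rewrite sD in iD; have [k ks ek] := In_nthP a0 ai.
    exists (Ordinal iD), k; rewrite nthE size_map //= ek.
    by split=> //; move: h; rewrite /lo /hi; lra.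
  move=> i j k l ik jl ne; rewrite !nthE //.
  have wlog_disj (i' j' : 'I_n) k' l' : (i' < j')%nat ->
      (k' < size [seq a.1 | a <- nth [::] D (nat_of_ord i')])%nat ->
      (l' < size [seq a.1 | a <- nth [::] D (nat_of_ord j')])%nat ->
      interior_disjoint (nth a0 (nth [::] D (nat_of_ord i')) k') (nth a0 (nth [::] D (nat_of_ord j')) l').
    by move=> lt /inN h1 /inN h2; apply: FOP_flatten dj lt h1 h2.
  case: (ltngtP (nat_of_ord i) (nat_of_ord j)) => [lt|gt|eij].
  + exact: wlog_disj.
  + by apply: interior_disjointC; apply: wlog_disj.
  + have {eij} eij : i = j by apply: val_inj.
    subst j; rewrite size_map in ik jl.
    have dji : List.ForallOrdPairs interior_disjoint (nth [::] D (nat_of_ord i)).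
      have : (i < size D)%nat by rewrite sD.
      elim: (D) (nat_of_ord i) dj => [|d D' IH] [|i'] //= /FOP_cat [] // h1 h2 _ lt.
      exact: IH.
    case: (ltngtP k l) => [lt|gt|ekl].
    * exact: FOP_nth dji lt jl.
    * by apply: interior_disjointC; apply: FOP_nth dji gt ik.
    * by case: ne; rewrite ekl.
- by move=> i k ik; rewrite nthE //; have [] := wf _ (inF _ _ (inN _ _ ik)).
Qed.

(** A piece becomes a list of atoms. Reordering, empty pieces and merging only regroup atoms; a cut
    becomes one cut query and [n] evaluations. [P] is chosen before [v], so it depends on the
    valuations through recorded values only. *)
Lemma win_realize (G : rel 'I_n) m K : win (final G) m K -> forall D, map total D = K -> tiling (flatten D) ->
  exists P, forall v, (forall i, is_valuation (v i)) -> known v (flatten D) ->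
    succeeds G v P m (n * m).
Proof.
elim=> {m K}.
- move=> m K [B -> noenvy] D eD tD.
  exists (Output (fun i : 'I_n => [seq a.1 | a <- nth [::] D (nat_of_ord i)])) => v _ kn.
  have sD : size D = n by move: (congr1 size eD); rewrite 2!size_map size_enum_ord.
  have tB (i : 'I_n) : total (nth [::] D (nat_of_ord i)) = B i.
    rewrite -(nth_map [::] (fun=> 0)) ?sD // eD (nth_map i) ?size_enum_ord //.
    by rewrite nth_ord_enum.
  apply: succeeds_output => //; first by rewrite eD; apply: eq_map => i; rewrite tB.
  by move=> i j Gij; rewrite !tB; apply: noenvy.
- move=> m K K' p _ IH D eD tD; subst K.
  have [D' [eD' pD]] := Permutation_map_inv _ _ (Permutation_sym p).
  have pF := flatten_perm pD.
  have [P HP] := IH D' (esym eD') (tiling_perm pF tD).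
  by exists P => v hv kn; apply: HP => //; apply: known_perm kn.
- move=> m K _ IH D eD tD; subst K.
  by have [P HP] := IH ([::] :: D) erefl tD; exists P.
- move=> m u w K _ IH [|d1 [|d2 D]] //= [e1 e2 eK] tD.
  have [||P HP] := IH ((d1 ++ d2) :: D).
  + rewrite /= eK; congr (_ :: _); apply: functional_extensionality => i.
    by rewrite total_cat /vadd -e1 -e2.
  + by rewrite /= -catA.
  + by exists P => v hv kn; apply: HP => //=; rewrite -catA.
- move=> m i tau u K h0 h1 _ IH [|d D] //= [eu eK] tD; subst u.
  (* A piece without atoms is worth zero to everyone and splits into two such pieces without any
     query. *)
  have [ed|dn] : d = [::] \/ d <> [::] by case: (d); [left|right].
    subst d.
    have t0 j : total [::] j = 0 by [].
    have [||||||P HP] // := IH (total [::]) (total [::]) _ _ _ _ ([::] :: [::] :: D).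
    + by move=> j; rewrite t0; lra.
    + by move=> j; rewrite t0; lra.
    + by move=> j; rewrite t0; lra.
    + by move: h0 h1; rewrite t0; lra.
    + by rewrite /= eK.
    exists P => v hv kn; apply: succeeds_le (HP v hv kn); first exact: leqnSn.
    by rewrite leq_mul2l leqnSn orbT.
  have [d1 [a [d2 [ed htau]]]] := total_locate dn (conj h0 h1); subst d.
  pose L := d1 ++ d2 ++ flatten D.
  have pL : Permutation ((d1 ++ a :: d2) ++ flatten D) (a :: L).
    rewrite -catA /=; apply: Permutation_sym; exact: Permutation_middle.
  pose newD z (w : vec) := [:: d1 ++ [:: (lo a, z, w)], (z, hi a, fun j => a.2 j - w j) :: d2 & D].
  have pN z w : Permutation [:: (lo a, z, w), (z, hi a, fun j => a.2 j - w j) & L] (flatten (newD z w)).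
    rewrite /= -catA /= /L.
    apply: Permutation_trans (Permutation_middle _ _ _); apply: perm_skip.
    exact: Permutation_middle.
  (* The continuation must be a function of the answers, whereas [IH] yields a protocol for fixed
     [z] and [w] only; [epsilon] selects one. *)
  pose good z w P := forall v, (forall i, is_valuation (v i)) -> known v (flatten (newD z w)) ->
    succeeds G v P m (n * m).
  pose strat z w := epsilon (inhabits (Output (fun _ : 'I_n => [::]))) (good z w).
  (* An admissible answer may exceed [hi a] if agent [i] values the excess at zero; [Rmin] moves the
     cut back into the atom. *)
  exists (CutQ i (lo a) (tau - total d1 i) (fun y =>
     let z := Rmin y (hi a) in eval_all (enum 'I_n) (lo a) z (fun=> 0) (strat z))) => v hv kn.
  have tL := tiling_perm pL tD; have kL := known_perm pL kn.
  have [wf _ _] := tL; have [a0 aa a1] := wf a (or_introl erefl).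
  have [vpos [vadd_ [vcut vone]]] := hv i.
  have ka : a.2 i = v i (lo a) (hi a) by apply: kL; left.
  have vxx j x : 0 <= x -> x <= 1 -> v j x x = 0.
    by move=> x0 x1; have [_ [va _]] := hv j; have := va x x x; lra.
  split=> //; do 2!(split; first by lra); split.
    case: (Req_dec (v i (lo a) (hi a)) 0) => [v0|v0].
      by exists (lo a); rewrite vxx; lra.
    have lam : 0 <= (tau - total d1 i) / v i (lo a) (hi a) <= 1.
      rewrite -ka in v0 *; split.
        by apply: Rmult_le_pos; [lra|apply: Rlt_le; apply: Rinv_0_lt_compat; lra].
      apply: (Rmult_le_reg_r (a.2 i)); first lra.
      by rewrite /Rdiv Rmult_assoc Rinv_l // ; lra.
    have [y [y1 [y2 y3]]] := vcut (lo a) (hi a) _ a0 aa a1 lam.1 lam.2.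
    exists y; split=> //; split; first lra.
    by rewrite y3 /Rdiv Rmult_assoc Rinv_l //; lra.
  move=> y ly y1 vy; set z := Rmin y (hi a).
  have [lz zh zy] : [/\ lo a <= z, z <= hi a & z <= y].
    by rewrite /z /Rmin; case: Rle_dec => ?; split; lra.
  have vz : v i (lo a) z = tau - total d1 i.
    case: (Rle_lt_dec y (hi a)) => yh; first by rewrite /z Rmin_left.
    rewrite /z Rmin_right; last lra.
    have := vadd_ (lo a) (hi a) y; have := vpos (hi a) y; lra.
  have -> : (n * m.+1 = size (enum 'I_n) + n * m)%nat by rewrite size_enum_ord mulnS.
  apply: eval_allP => //; try lra.
  set w := (w in strat z w).
  have wE j : w j = v j (lo a) z by rewrite /w mem_enum.
  have aE j : a.2 j = v j (lo a) z + v j z (hi a).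
    by rewrite kL; [apply: (hv j).2.1 => //; lra | left].
  have kN : known v (flatten (newD z w)).
    apply: known_perm (pN z w) _; apply: known_split kL => // j.
    by rewrite aE wE; lra.
  have tN : tiling (flatten (newD z w)).
    by apply: tiling_perm (pN z w) _; apply: tiling_split tL; lra.
  have [wfN _ _] := tN.
  suff : good z w (strat z w) by move=> /(_ v hv kN).
  apply: epsilon_spec.
  have [|||||P HP] := IH (total (d1 ++ [:: (lo a, z, w)])) (total ((z, hi a, fun j => a.2 j - w j) :: d2))
     _ _ _ _ (newD z w) _ tN.
  + by apply: (@total_ge0 v) => // b bI; [apply: kN|apply: wfN]; apply: In_flatten bI; left.
  + by apply: (@total_ge0 v) => // b bI; [apply: kN|apply: wfN]; apply: In_flatten bI; right; left.
  + by move=> j; rewrite !total_cat !total_cons /=; lra.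
  + by rewrite total_cat total_cons /= wE vz; lra.
  + by rewrite /newD /= eK.
  + by exists P.
Qed.

Theorem win_protocol (G : rel 'I_n) m : win (final G) m [:: fun=> 1] ->
  exists P, forall v, (forall i, is_valuation (v i)) -> succeeds G v P m (n * m).
Proof.
move=> W; have [||P HP] := win_realize W (D := [:: [:: (0, 1, fun=> 1)]]).
- by congr [:: _]; apply: functional_extensionality => i; rewrite /total /=; lra.
- split=> [a /= [<-|] //||t t0 t1].
  + by rewrite /lo /hi /=; split; lra.
  + by repeat constructor.
  + by exists (0, 1, fun=> 1); [left|].
- exists P => v hv; apply: HP => // a /= [<-|] // i.
  by have [_ [_ [_ ->]]] := hv i.
Qed.

End Game.

(** * Sharing the pieces of one round *)

Lemma Rplus_associative : associative Rplus.
Proof. by move=> x y z; rewrite Rplus_assoc. Qed.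

HB.instance Definition _ :=
  Monoid.isComLaw.Build R 0 Rplus Rplus_associative Rplus_comm Rplus_0_l.

Lemma rsum_le (I : finType) (P : pred I) (f g : I -> R) :
  (forall i, P i -> f i <= g i) -> \big[Rplus/0]_(i | P i) f i <= \big[Rplus/0]_(i | P i) g i.
Proof. by move=> H; apply: (big_ind2 Rle) => // *; lra. Qed.

Lemma rsum_ge0 (I : finType) (P : pred I) (f : I -> R) :
  (forall i, P i -> 0 <= f i) -> 0 <= \big[Rplus/0]_(i | P i) f i.
Proof. by move=> H; apply: (big_ind (Rle 0)) => // *; lra. Qed.

Lemma rsum_const (m : nat) (c : R) : \big[Rplus/0]_(i < m) c = INR m * c.
Proof.
rewrite big_const_ord; elim: m => [|m IH]; first by rewrite /=; lra.
by rewrite iterS IH S_INR; lra.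
Qed.

Lemma list_argmax (T : Type) (f : T -> R) (s : seq T) : s <> [::] ->
  exists s1 p s2, s = s1 ++ p :: s2 /\ forall q, List.In q s -> f q <= f p.
Proof.
elim: s => [//|a s IH] _.
have [->|/IH [s1 [p [s2 [es H]]]]] : s = [::] \/ s <> [::] by case: (s); [left|right].
  by exists [::], a, [::]; split=> // q [<-|//]; lra.
case: (Rle_lt_dec (f p) (f a)) => h.
  by exists [::], a, s; split=> // q [<-|/H]; lra.
by exists (a :: s1), p, s2; split=> [|q [<-|/H]]; [rewrite es|lra|].
Qed.

Lemma fin_argmax (T : finType) (C : pred T) (f : T -> R) t0 : C t0 ->
  exists2 t, C t & forall t', C t' -> f t' <= f t.
Proof.
move=> Ct0.
have memIn (t : T) s : t \in s -> List.In t s.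
  by elim: s => //= a s IH; rewrite inE => /orP [/eqP ->|/IH]; [left|right].
have [|s1 [p [s2 [es H]]]] := @list_argmax _ f (enum C).
  by move=> e0; have := mem_enum C t0; rewrite e0 [t0 \in C]Ct0.
exists p; last by move=> t' Ct'; apply/H/memIn; rewrite mem_enum.
have : p \in enum C by rewrite es mem_cat inE eqxx orbT.
by rewrite mem_enum.
Qed.

Section Assignment.
Variable n : nat.
Implicit Types (a : {perm 'I_n}) (u w : 'I_n).

(* An assignment of maximal welfare over [S] is optimal for the swap of
   [u] in [S] with [w] outside of [S], which affects the welfare of [u] only. *)
Lemma opt_noenvy (C : pred {perm 'I_n}) (S : pred 'I_n) (f : 'I_n -> 'I_n -> R) a u w :
  (forall a', C a' -> \big[Rplus/0]_(i | S i) f i (a' i) <= \big[Rplus/0]_(i | S i) f i (a i)) ->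
  S u -> ~~ S w -> C (tperm u w * a)%g -> f u (a w) <= f u (a u).
Proof.
move=> opt Su Sw Ca; have := opt _ Ca.
rewrite (bigD1 u) //= [X in _ <= X -> _](bigD1 u) //= permM tpermL.
rewrite (eq_bigr (fun i => f i (a i))); first lra.
move=> i /andP [Si iu]; rewrite permM tpermD //; first by rewrite eq_sym.
by apply: contra Sw => /eqP ->.
Qed.

Definition alloc := 'I_n -> vec n.
Implicit Types rho : alloc.

(** A leaf is sent to its centre, while centres and the root are fixed: the fibres of [par] are the
    groups, with [r] alone in its own. *)
Variables (r : 'I_n) (par : 'I_n -> 'I_n).
Hypothesis par_root : par r = r.
Hypothesis par_eq_root : forall u, par u = r -> u = r.
Hypothesis par_idem : forall u, par (par u) = par u.

Definition group_preserving a : bool := [forall u, par (a u) == par u].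

Lemma group_preservingP a u : group_preserving a -> par (a u) = par u.
Proof. by move/forallP => /(_ u) /eqP. Qed.

Lemma group_preserving1 : group_preserving 1%g.
Proof. by apply/forallP => u; rewrite perm1. Qed.

Lemma group_preservingM a a' :
  group_preserving a -> group_preserving a' -> group_preserving (a * a')%g.
Proof. by move=> h h'; apply/forallP => u; rewrite permM !group_preservingP. Qed.

Lemma group_preserving_tperm u w : par u = par w -> group_preserving (tperm u w).
Proof. by move=> e; apply/forallP => x; case: tpermP => [->|->|]; rewrite ?e. Qed.

Definition relabel rho a : alloc := fun u => rho (a u).

(** For centres and the root this is trivial, as [par u = u]. *)
Definition leaf_content rho : Prop := forall u, rho (par u) u <= rho u u.

Record fair rho : Prop := Fair {
  fair_ge0 : forall u, nneg (rho u);
  fair_group : forall u, rho u (par u) = rho (par u) (par u);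
  fair_top : forall k, par k = k -> rho r k <= rho k k;
  fair_root : forall u, rho u r <= rho r r }.

Lemma group_preserving_root a : group_preserving a -> a r = r.
Proof. by move=> ga; apply: par_eq_root; rewrite group_preservingP. Qed.

(** By [fair_group] a centre is indifferent between the pieces of its group, so permuting them does
    not affect it; the root, alone in its group, keeps its piece. *)
Lemma fair_relabel rho a : group_preserving a -> fair rho -> fair (relabel rho a).
Proof.
move=> ga [f0 fg ft fr]; have ar := group_preserving_root ga.
have val u : rho (a u) (par u) = rho (par u) (par u).
  by have := fg (a u); rewrite group_preservingP.
split=> [u|u|k ek|u]; rewrite /relabel; [exact: f0| | |by rewrite ar; exact: fr].
- by have := val (par u); rewrite par_idem => ->; apply: val.
- by rewrite ar; have := val k; rewrite ek => ->; apply: ft.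
Qed.

Definition alloc_add rho rho' : alloc := fun u => vadd (rho u) (rho' u).

Lemma fair_add rho rho' : fair rho -> fair rho' -> fair (alloc_add rho rho').
Proof.
move=> [f0 fg ft fr] [f0' fg' ft' fr']; split; rewrite /alloc_add /vadd.
- by move=> u i; have := f0 u i; have := f0' u i; lra.
- by move=> u; rewrite fg fg'.
- by move=> k ek; have := ft k ek; have := ft' k ek; lra.
- by move=> u; have := fr u; have := fr' u; lra.
Qed.

Lemma leaf_content_add rho rho' :
  leaf_content rho -> leaf_content rho' -> leaf_content (alloc_add rho rho').
Proof. by move=> h h' u; have := h u; have := h' u; rewrite /alloc_add /vadd; lra. Qed.

Definition leaf u : bool := par u != u.

Lemma leaf_par u : ~~ leaf (par u).
Proof. by rewrite /leaf par_idem eqxx. Qed.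

(** Welfare is maximized over the leaves only: a leaf envying its centre could swap with it and
    raise the sum, since the centre's loss does not count. *)
Lemma content_relabeling rho :
  exists2 a, group_preserving a & leaf_content (relabel rho a).
Proof.
have [a ga opt] := fin_argmax (fun a => \big[Rplus/0]_(i | leaf i) rho (a i) i) group_preserving1.
exists a => // u; rewrite /relabel; case: (boolP (leaf u)) => [lu|/negPn /eqP ->]; last lra.
apply: (opt_noenvy (f := fun i j => rho j i) opt lu (leaf_par u)).
by apply: group_preservingM => //; apply: group_preserving_tperm; rewrite par_idem.
Qed.

(* Forcing the piece [s] upon the centre [k] costs the leaf [l] at most what it
   gains under a suitable relabeling in which it gets [s] itself: both are
   assignments of maximal welfare, and exchanging [k] and [l] turns the
   assignments competing for the one maximum into those competing for the other. *)
Lemma forced_relabeling rho s (k := par s) :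
  exists F, [/\ group_preserving F, F k = s,
    forall u, par u <> k -> rho (F (par u)) u <= rho (F u) u &
    forall l, par l = k -> exists M, [/\ group_preserving M, leaf_content (relabel rho M) &
      rho (F k) l - rho (F l) l <= rho (M l) l - rho (M k) l]].
Proof.
have kk : par k = k by rewrite /k par_idem.
have start u : par u = k -> group_preserving (tperm u s) && (tperm u s u == s).
  by move=> e; rewrite tpermL eqxx andbT; apply: group_preserving_tperm; rewrite e.
have [F /andP [gF /eqP Fk] optF] :=
  fin_argmax (C := fun a => group_preserving a && (a k == s))
    (fun a => \big[Rplus/0]_(i | leaf i) rho (a i) i) (start k kk).
exists F; split=> //.
  move=> u uk; case: (boolP (leaf u)) => [lu|/negPn /eqP ->]; last lra.
  apply: (opt_noenvy (f := fun i j => rho j i) optF lu (leaf_par u)).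
  rewrite group_preservingM ?group_preserving_tperm ?par_idem //=.
  rewrite permM tpermD ?Fk //.
    by apply/eqP => e; apply: uk; rewrite e.
  by apply/eqP.
move=> l lk.
case: (eqVneq l k) => [->|lnk].
  have [M gM cM] := content_relabeling rho.
  by exists M; split=> //; lra.
have leafl : leaf l by rewrite /leaf lk eq_sym.
case: (Rle_lt_dec (rho (F k) l) (rho (F l) l)) => [le|lt].
  have [M gM cM] := content_relabeling rho.
  by exists M; split=> //; have := cM l; rewrite /relabel lk; lra.
have [M /andP [gM /eqP Ml] optM] :=
  fin_argmax (C := fun a => group_preserving a && (a l == s))
    (fun a => \big[Rplus/0]_(i | leaf i && (i != l)) rho (a i) i) (start l lk).
have gkl : group_preserving (tperm l k) by apply: group_preserving_tperm; rewrite lk kk.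
have swap f (a : {perm 'I_n}) :
    \big[Rplus/0]_(i | leaf i && (i != l)) f i ((tperm l k * a)%g i) =
    \big[Rplus/0]_(i | leaf i && (i != l)) f i (a i) :> R.
  apply: eq_bigr => i /andP [li il]; rewrite permM tpermD // eq_sym //.
  by apply: contraTneq li => ->; rewrite /leaf kk eqxx.
have h1 := optF (tperm l k * M)%g.
have h2 := optM (tperm l k * F)%g.
(* By [h2] the leaves other than [l] fare at least as well under [M] as under [F]; their welfare
   cancels against [h1], leaving the terms of [l]. *)
have {h1} h1 : rho (M k) l <= rho (F l) l.
  move: h1; rewrite group_preservingM //= permM tpermR Ml eqxx => /(_ isT).
  rewrite (bigD1 l) //= [X in _ <= X -> _](bigD1 l) //= permM tpermL.
  rewrite (swap (fun i j => rho j i)).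
  move: h2; rewrite group_preservingM //= permM tpermL Fk eqxx => /(_ isT).
  rewrite (swap (fun i j => rho j i)).
  have cancel (x y z t : R) : x <= y -> z + y <= t + x -> z <= t by lra.
  exact: cancel.
have gain : rho (F k) l - rho (F l) l <= rho (M l) l - rho (M k) l.
  by rewrite Ml Fk; lra.
exists M; split=> // u; rewrite /relabel.
(* For [l] contentment follows from [gain], since by [lt] forcing has a positive cost. *)
case: (eqVneq u l) => [->|ul]; first by rewrite lk; lra.
case: (boolP (leaf u)) => [lu|/negPn /eqP ->]; last lra.
apply: (opt_noenvy (f := fun i j => rho j i) optM); rewrite ?lu ?(negbTE (leaf_par u)) //.
rewrite group_preservingM ?group_preserving_tperm ?par_idem //=.
rewrite permM tpermD ?Ml //.
by apply: contraNneq (leaf_par u) => ->.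
Qed.

End Assignment.

(** * Rounds *)

Section Protocol.
Variable n : nat.
Notation alloc := (alloc n).
Notation vec := (vec n).

(** Equality of vectors is not decidable, so counts range over arbitrary predicates; rearranging
    lists then becomes linear arithmetic. *)
Lemma permutation_count (T : Type) (s s' : seq T) :
  (forall p : pred T, count p s = count p s') -> Permutation s s'.
Proof.
elim: s s' => [|a s IH] s'.
  by case: s' => [//|b s'] /(_ predT).
move=> H; move: (H).
pose p : pred T := fun x => if excluded_middle_informative (x = a) then true else false.
have pa : p a by rewrite /p; case: excluded_middle_informative.
have /split_find [x s1 s2 px _] : has p s' by rewrite has_count -H /= pa.
have ex : x = a by move: px; rewrite /p; case: excluded_middle_informative.
subst x; rewrite cat_rcons => Hs; apply: Permutation_cons_app; apply: IH => q.
by have := Hs q; rewrite /= !count_cat /=; lia.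
Qed.

Lemma win_weaken (Phi Psi : seq vec -> Prop) m K :
  (forall K', Phi K' -> Psi K') -> win Phi m K -> win Psi m K.
Proof. by move=> H w; rewrite -[m]addn0; apply: win_bind w _ => K' /H; apply: WinDone. Qed.

Definition row (rho : alloc) : seq vec := map rho (enum 'I_n).
Definition rows (H : seq alloc) : seq vec := flatten (map row H).

Lemma row_relabel rho (a : {perm 'I_n}) : Permutation (row (relabel rho a)) (row rho).
Proof.
apply: permutation_count => p; rewrite /row /relabel (map_comp rho a) !(count_map rho).
apply/seq.permP/uniq_perm; [|exact: enum_uniq|].
  by rewrite map_inj_uniq ?enum_uniq //; apply: perm_inj.
move=> u; rewrite mem_enum; apply/mapP; exists ((a^-1)%g u); first by rewrite mem_enum.
by rewrite permKV.
Qed.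

Lemma win_zeros Phi m (s : seq 'I_n) K :
  win Phi m (map (fun=> (fun=> 0) : vec) s ++ K) -> win Phi m K.
Proof.
elim: s K => //= u s IH K w; apply: WinZero; apply: IH.
by apply: WinPerm w; apply: Permutation_sym; apply: Permutation_middle.
Qed.

Lemma win_merge_map Phi m (rho rho' : alloc) s K :
  win Phi m (map (alloc_add rho rho') s ++ K) -> win Phi m (map rho s ++ map rho' s ++ K).
Proof.
elim: s K => //= u s IH K w.
apply: (@WinPerm _ _ _ _ ([:: rho u, rho' u & map rho s ++ map rho' s ++ K])).
  by apply: permutation_count => p; rewrite /= !count_cat /= !count_cat; lia.
apply: WinMerge.
apply: (@WinPerm _ _ _ _ (map rho s ++ map rho' s ++ vadd (rho u) (rho' u) :: K)).
  by apply: permutation_count => p; rewrite /= !count_cat /=; lia.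
apply: IH; apply: WinPerm w.
by apply: permutation_count => p; rewrite /= !count_cat /= /alloc_add; lia.
Qed.

Lemma win_merge_sum Phi m (T : alloc) (s : seq 'I_n) K :
  win Phi m ((fun j => \big[Rplus/0]_(u <- s) T u j) :: K) -> win Phi m (map T s ++ K).
Proof.
elim: s K => [|u s IH] K w /=.
  apply: WinZero; congr (win Phi m (_ :: K)): w.
  by apply: functional_extensionality => j; rewrite big_nil.
apply: (@WinPerm _ _ _ _ (map T s ++ T u :: K)).
  by apply: permutation_count => p; rewrite /= !count_cat /=; lia.
apply: IH; apply: WinMerge; congr (win Phi m (_ :: K)): w.
by apply: functional_extensionality => j; rewrite big_cons Rplus_comm.
Qed.

(** Regrouping the pieces of [H] into [A] is expressed by its effect on the game: it costs no cut
    and works beside any other pieces. *)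
Definition mergeable (H : seq alloc) (A : alloc) : Prop :=
  forall Phi m K, win Phi m (row A ++ K) -> win Phi m (rows H ++ K).

Lemma mergeable_nil : mergeable [::] (fun _ _ => 0).
Proof. by move=> Phi m K; apply: win_zeros. Qed.

Lemma mergeable_cat H H' A A' :
  mergeable H A -> mergeable H' A' -> mergeable (H ++ H') (alloc_add A A').
Proof.
move=> mH mH' Phi m K w; rewrite /rows map_cat flatten_cat -catA -!/(rows _); apply: mH.
apply: (@WinPerm _ _ _ _ (rows H' ++ row A ++ K)).
  by apply: permutation_count => p; rewrite !count_cat; lia.
apply: mH'; apply: (@WinPerm _ _ _ _ (row A ++ row A' ++ K)).
  by apply: permutation_count => p; rewrite !count_cat; lia.
exact: win_merge_map.
Qed.

Lemma mergeable1 rho (a : {perm 'I_n}) : mergeable [:: rho] (relabel rho a).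
Proof.
move=> Phi m K w; apply: WinPerm w; rewrite /rows /= cats0.
by apply: Permutation_app_tail; apply: Permutation_sym; apply: row_relabel.
Qed.

Lemma mergeable_perm H H' A : Permutation H H' -> mergeable H' A -> mergeable H A.
Proof.
move=> p mH Phi m K /mH; apply: WinPerm; apply: Permutation_app_tail.
by apply: flatten_perm; apply: (Permutation_map row).
Qed.

(** * The cuts and trimmings of one round *)

Lemma win_split (i : 'I_n) m (u : vec) K : nneg u ->
  win (fun K' => exists qs : seq vec, [/\ Permutation K' (qs ++ K), size qs = m.+1,
        forall q, List.In q qs -> nneg q /\ INR m.+1 * q i = u i &
        forall j, \big[Rplus/0]_(q <- qs) q j = u j]) m (u :: K).
Proof.
elim: m u K => [|m IH] u K u0.
  apply: WinDone; exists [:: u]; split=> //.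
    by move=> q [<-|//]; split=> //; rewrite /=; lra.
  by move=> j; rewrite big_seq1.
have m0 := lt_0_INR m.+1 (ltP (ltn0Sn m)); have := S_INR m.+1 => eS.
have c0 : 0 <= u i / INR m.+2.
  by apply: Rmult_le_pos; [exact: u0|apply: Rlt_le; apply: Rinv_0_lt_compat; lra].
have c1 : INR m.+2 * (u i / INR m.+2) = u i by field; lra.
apply: (@WinCut _ _ m i (u i / INR m.+2)) => //; first by rewrite eS in c0 c1 *; nra.
move=> u1 u2 p1 p2 e12 e1; apply: WinPerm (perm_swap _ _ _) _.
apply: win_weaken (IH u2 (u1 :: K) p2) => K' [qs [pK sq Hq Sq]].
exists (u1 :: qs); split.
- apply: Permutation_trans pK _; apply: permutation_count => p.
  by rewrite /= !count_cat /=; lia.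
- by rewrite /= sq.
- move=> q [<-|/Hq [q0 eq]]; first by split=> //; rewrite e1.
  split=> //; have := e12 i; rewrite e1 => e2.
  have : INR m.+1 * q i = INR m.+1 * (u i / INR m.+2) by move: c1; set X := u i / _; rewrite eS => c1; rewrite -/X in e2; lra.
  by move=> /Rmult_eq_reg_l -> //; lra.
- by move=> j; rewrite big_cons Sq e12.
Qed.

Lemma win_trim (c : 'I_n -> 'I_n) (tau : 'I_n -> R) (f : alloc) s K :
  (forall u, 0 <= tau u <= f u (c u)) -> uniq s ->
  win (fun K' => exists P T : alloc,
       [/\ Permutation K' (map P s ++ map T s ++ K),
           forall u, u \in s -> nneg (P u) /\ nneg (T u),
           forall u j, u \in s -> f u j = P u j + T u j &
           forall u, u \in s -> P u (c u) = tau u]) (size s) (map f s ++ K).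
Proof.
move=> Htau; elim: s K => [|u s IH] K /=.
  by move=> _; apply: WinDone; exists f, f; split.
move=> /andP [us uqs]; have [t0 t1] := Htau u.
apply: (WinCut t0 t1) => u1 u2 p1 p2 e12 e1.
apply: (@WinPerm _ _ _ _ (map f s ++ [:: u1, u2 & K])).
  by apply: permutation_count => p; rewrite /= !count_cat /=; lia.
apply: win_weaken (IH [:: u1, u2 & K] uqs) => K' [P [T [pK h1 h2 h3]]].
exists (fun w => if w == u then u1 else P w), (fun w => if w == u then u2 else T w).
have off (g : alloc) (y : vec) : map (fun w => if w == u then y else g w) s = map g s.
  by apply/eq_in_map => w ws; case: eqP => // e; rewrite -e ws in us.
split=> [|w|w j|w]; rewrite ?eqxx ?off.
- apply: Permutation_trans pK _; apply: permutation_count => p.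
  by rewrite /= !count_cat /= !count_cat /=; lia.
- by rewrite inE; case: eqP => //= _; apply: h1.
- by rewrite inE; case: eqP => [->|] //= _; apply: h2.
- by rewrite inE; case: eqP => [->|] //= _; apply: h3.
Qed.

Lemma row_nth (qs : seq vec) : size qs = n ->
  qs = row (fun u => nth (fun=> 0) qs (nat_of_ord u)).
Proof.
move=> sq; apply: (@eq_from_nth _ (fun=> 0)); first by rewrite size_map size_enum_ord.
rewrite sq => i lt; rewrite /row (nth_map (Ordinal lt)) ?size_enum_ord //.
by rewrite (nth_ord_enum (Ordinal lt) (Ordinal lt)).
Qed.

Variables (r : 'I_n) (par : 'I_n -> 'I_n).
Hypothesis par_root : par r = r.
Hypothesis par_eq_root : forall u, par u = r -> u = r.
Hypothesis par_idem : forall u, par (par u) = par u.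

Lemma In_row rho u : List.In (rho u) (row rho).
Proof.
have : u \in enum 'I_n by rewrite mem_enum.
rewrite /row; elim: (enum _) => //= w s IH; rewrite inE => /orP [/eqP ->|/IH]; first by left.
by right.
Qed.

(** The root makes [n - 1] cuts and each part is trimmed once. All parts were equal for [r] and its
    own loses no value for it, so each summand in [x' r] is the value of one trimming. *)
Lemma win_round x K : nneg x ->
  win (fun K' => exists rho x', [/\ Permutation K' (x' :: row rho ++ K), nneg x', fair r par rho,
         INR n * rho r r = x r &
         x' r = \big[Rplus/0]_(u : 'I_n) (rho r r - rho u r)]) (n + n) (x :: K).
Proof.
move=> x0; have n0 : (0 < n)%nat by apply: leq_ltn_trans (ltn_ord r).
have nE : n.-1.+1 = n by rewrite prednK.
have rn0 : 0 < INR n by apply: lt_0_INR; apply/ltP.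
apply: (@win_le _ _ (n.-1 + n)); first by rewrite leq_add2r leq_pred.
apply: win_bind (win_split r _ K x0) _ => K1 [qs []]; rewrite nE => pK1 sq Hq _.
pose Q : alloc := fun u => nth (fun=> 0) qs (nat_of_ord u).
have eq : qs = row Q := row_nth sq.
have HQ u : nneg (Q u) /\ INR n * Q u r = x r by apply: Hq; rewrite [X in List.In _ X]eq; apply: In_row.
(* Each part is rated by the centre of the group taking it, and the part of [r] is not counted;
   optimality makes it no better for a centre than any part of that centre's group. *)
have [s _ opt] := fin_argmax (C := predT)
  (fun s : {perm 'I_n} => \big[Rplus/0]_(u | u != r) Q (s u) (par u)) (t0 := 1%g) isT.
pose f : alloc := relabel Q s.
have f0 u : nneg (f u) by case: (HQ (s u)).
have fr u : INR n * f u r = x r by case: (HQ (s u)).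
have ftop u : f r (par u) <= f u (par u).
  case: (eqVneq u r) => [->|ur]; first by lra.
  by apply: (opt_noenvy (f := fun i j => Q j (par i)) (C := predT) opt); rewrite ?eqxx.
(* [g k] is the least value for the centre [k] of a part in its group, the level of trimming; 0 is a
   filler for agents not fixed by [par]. *)
have /fin_all_exists [g gP] : forall k, exists z, par k = k ->
    (exists2 t, par t = k & z = f t k) /\ forall t, par t = k -> z <= f t k.
  move=> k; case: (eqVneq (par k) k) => [kk|/eqP nk]; last by exists 0 => /nk.
  have [t /eqP tk min] := fin_argmax (C := fun t => par t == k) (fun t => - f t k)
    (introT eqP kk).
  exists (f t k) => _; split; first by exists t.
  by move=> t' /eqP /min; lra.
have Htau u : 0 <= g (par u) <= f u (par u).
  have [[t _ e] min] := gP (par u) (par_idem u).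
  by split; [rewrite e; exact: f0 | exact: min].
apply: (@WinPerm _ _ _ _ (row f ++ K)).
  apply: Permutation_trans pK1 _; apply: Permutation_app_tail; rewrite eq.
  by apply: Permutation_sym; apply: row_relabel.
apply: (@win_le _ _ (size (enum 'I_n) + 0)); first by rewrite size_enum_ord addn0.
apply: win_bind (win_trim (c := par) K Htau (enum_uniq 'I_n)) _ => K' [P [T [pK' ge0 fE tauE]]].
have {}ge0 u : nneg (P u) /\ nneg (T u) by apply: ge0; rewrite mem_enum.
have {}fE u j : f u j = P u j + T u j by apply: fE; rewrite mem_enum.
have {}tauE u : P u (par u) = g (par u) by apply: tauE; rewrite mem_enum.
(* The root's group has one part, so its minimum is the value of that part itself. *)
have Prr : INR n * P r r = x r.
  have [[t /par_eq_root -> e] _] := gP r par_root.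
  by have := tauE r; rewrite par_root e => ->; apply: fr.
have fPr u : f u r = P r r.
  by apply: (Rmult_eq_reg_l (INR n)); [rewrite fr Prr|lra].
apply: WinPerm pK' _; apply: (@WinPerm _ _ _ _ (row T ++ row P ++ K)).
  change (Permutation (row P ++ row T ++ K) (row T ++ row P ++ K)).
  by apply: permutation_count => p; rewrite !count_cat; lia.
apply: win_merge_sum; apply: WinDone; exists P, (fun j => \big[Rplus/0]_(u <- enum 'I_n) T u j).
split=> //.
- by move=> j; rewrite big_enum; apply: rsum_ge0 => u _; apply: (ge0 u).2.
- split.
  + by move=> u; apply: (ge0 u).1.
  + by move=> u; have := tauE (par u); rewrite par_idem => ->.
  + move=> k kk; have := tauE k; rewrite kk => ->.
    have [[t tk ->] _] := gP k kk; have := ftop t; rewrite tk.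
    by have := fE r k; have := (ge0 r).2 k; lra.
  + by move=> u; have := fE u r; have := (ge0 u).2 r; rewrite fPr; lra.
- rewrite big_enum /=; apply: eq_bigr => u _.
  by have := fE u r; rewrite fPr; lra.
Qed.

(** What leaves the residue is worth at least the root's own piece, an [n]-th of [x r]. *)
Lemma round_shrinks rho x x' : fair r par rho -> INR n * rho r r = x r ->
  x' r = \big[Rplus/0]_(u : 'I_n) (rho r r - rho u r) -> INR n * x' r <= (INR n - 1) * x r.
Proof.
move=> fr e1 e2.
have : x' r + \big[Rplus/0]_(u : 'I_n) rho u r = x r.
  rewrite e2 -big_split /= -e1 -rsum_const; apply: eq_bigr => u _; lra.
have : rho r r <= \big[Rplus/0]_(u : 'I_n) rho u r.
  rewrite (bigD1 r) //=.
  rewrite -[X in X <= _]Rplus_0_r; apply: Rplus_le_compat_l.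
  by apply: rsum_ge0 => u _; apply: (fair_ge0 fr).
by have := pos_INR n; nra.
Qed.

(** The residue consists of [n] trimmings, so the largest is at least the average; the root's own is
    worth zero to it and can be ignored. *)
Lemma round_special rho (x' : vec) u0 : u0 != r -> fair r par rho ->
  x' r = \big[Rplus/0]_(u : 'I_n) (rho r r - rho u r) ->
  exists2 s, s != r & x' r <= INR n * (rho r r - rho s r).
Proof.
move=> u0r fr e.
have [s sr opt] := fin_argmax (C := fun u => u != r) (fun u => rho r r - rho u r) u0r.
exists s => //; rewrite e -rsum_const; apply: rsum_le => u _.
case: (eqVneq u r) => [->|/opt //]; have := fair_root fr s; lra.
Qed.

(** A decay by [n / (n + N)] replaces the geometric one and suffices. The special parts are compared
    with the last residue, as residues never grow for [r]. *)
Lemma win_rounds u0 N x K : u0 != r -> nneg x ->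
  win (fun K' => exists x' H, [/\ Permutation K' (x' :: rows H ++ K), nneg x' /\ size H = N,
         List.Forall (fair r par) H,
         List.Forall (fun rho => exists2 s, s != r & x' r <= INR n * (rho r r - rho s r)) H &
         (INR n + INR N) * x' r <= INR n * x r]) (N * (n + n)) (x :: K).
Proof.
move=> u0r x0; elim: N => [|N IH].
  by apply: WinDone; exists x, [::]; split=> //=; lra.
rewrite mulSn addnC; apply: win_bind IH _ => K1 [x1 [H [p1 [x10 sH] fH spH le1]]].
apply: WinPerm p1 _; apply: win_weaken (win_round _ x10) => K2 [rho [x2 [p2 x20 fr e1 e2]]].
have rn1 : 1 <= INR n.
  by apply: (le_INR 1); apply/leP; apply: leq_ltn_trans (ltn_ord r).
have sh := round_shrinks fr e1 e2.
have le21 : x2 r <= x1 r by have := x10 r; have := x20 r; nra.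
exists x2, (rho :: H); split.
- by rewrite /rows /= -catA.
- by rewrite /= sH.
- by constructor.
- constructor; first exact: (round_special u0r fr e2).
  by apply: List.Forall_impl spH => rho' [s sr le]; exists s => //; lra.
- have N0 := pos_INR N; have := x10 r; have := x20 r; rewrite S_INR.
  have : (INR n + INR N + 1) * (INR n * x2 r) <= (INR n + INR N + 1) * ((INR n - 1) * x1 r).
    by apply: Rmult_le_compat_l; lra.
  move=> h h2 h1.
  (* This rests on [(n + N + 1) * (n - 1) <= n * (n + N)]. *)
  have h3 : INR n * ((INR n + INR N + 1) * x2 r) <= INR n * ((INR n + INR N) * x1 r) by nra.
  by have := Rmult_le_reg_l _ _ _ (Rlt_le_trans _ _ _ Rlt_0_1 rn1) h3; lra.
Qed.

(** * Dominating a centre *)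

Lemma Forall_choice (T U : Type) (P : T -> U -> Prop) (s : seq T) :
  List.Forall (fun x => exists y, P x y) s ->
  exists2 z : seq (T * U), map fst z = s & List.Forall (fun p => P p.1 p.2) z.
Proof.
elim=> {s} [|x s [y Pxy] _ [z <- Pz]]; first by exists [::].
by exists ((x, y) :: z) => //; constructor.
Qed.

Lemma pigeonhole (T : Type) (P : T -> 'I_n -> Prop) m (s : seq T) :
  List.Forall (fun x => exists k, P x k) s -> (n * m < size s)%nat ->
  exists k s1 s2, [/\ Permutation s (s1 ++ s2), (m < size s1)%nat & List.Forall (P^~ k) s1].
Proof.
move=> /Forall_choice [z <- Pz]; rewrite size_map => lt.
have sizeE : size z = (\sum_(k < n) count (fun p : T * 'I_n => p.2 == k) z)%nat.
  elim: (z) => [|p z' IH] /=; first by rewrite big1.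
  by rewrite big_split /= (bigD1 p.2) //= eqxx big1 -?IH // => k; rewrite eq_sym => /negbTE ->.
have [k ltk] : exists k : 'I_n, (m < count (fun p : T * 'I_n => p.2 == k) z)%nat.
  apply/existsP; apply: contraLR lt; rewrite negb_exists -leqNgt sizeE => /forallP le.
  have <- : (\sum_(k < n) m = n * m)%nat by rewrite sum_nat_const card_ord.
  apply: leq_sum => k _.
  by rewrite leqNgt; apply: le.
exists k, (map fst (filter (fun p => p.2 == k) z)), (map fst (filter (fun p => p.2 != k) z)).
split; last 2 first.
- by rewrite size_map size_filter.
- elim: Pz => //= p z' Pp _ IH; case: eqP => [e|//].
  by constructor; [rewrite /= -e|].
rewrite -map_cat; apply: (Permutation_map fst); apply: permutation_count => p.
rewrite count_cat !count_filter -count_predUI.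
rewrite -[RHS]/(_ + _)%nat [X in (_ + X)%nat](eq_count (a2 := pred0)) ?count_pred0 ?addn0.
  by apply: eq_count => y /=; case: (y.2 == k); rewrite ?andbT ?andbF ?orbF.
by move=> y /=; case: (y.2 == k); rewrite ?andbT ?andbF.
Qed.

Lemma content_merge H : List.Forall (fair r par) H ->
  exists A, [/\ mergeable H A, fair r par A & leaf_content par A].
Proof.
elim=> {H} [|rho H fr _ [A [mA fA cA]]].
  by exists (fun _ _ => 0); split; [exact: mergeable_nil|split=> *; try move=> ?; lra|move=> u; lra].
have [a ga ca] := content_relabeling par_idem rho.
exists (alloc_add (relabel rho a) A); split.
- by rewrite -cat1s; apply: mergeable_cat => //; apply: mergeable1.
- by apply: fair_add => //; apply: fair_relabel.
- exact: leaf_content_add.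
Qed.

(* [y l] is the cost for the leaf [l] of forcing on [k] a piece that [r] values
   less than its own by [delta]; another relabeling brings [l] that much back. *)
Definition forcible (k : 'I_n) (delta : R) (rho : alloc) (y : vec) : Prop :=
  [/\ fair r par rho,
      exists F, [/\ group_preserving par F, delta <= rho r r - rho (F k) r,
        forall u, par u <> k -> rho (F (par u)) u <= rho (F u) u &
        forall u, par u = k -> rho (F k) u - rho (F u) u <= y u] &
      forall l, par l = k -> exists M, [/\ group_preserving par M,
        leaf_content par (relabel rho M) & y l <= rho (M l) l - rho (M k) l]].

Lemma forcible_exists delta rho s : fair r par rho -> delta <= rho r r - rho s r ->
  exists y, forcible (par s) delta rho y.
Proof.
move=> fr le; have [F [gF Fk cF MF]] := forced_relabeling par_idem rho s.
exists (fun u => rho (F (par s)) u - rho (F u) u); split=> //.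
by exists F; split=> // [|u _]; [rewrite Fk|lra].
Qed.

(* Each leaf of [Ls] in turn reserves the round where its cost is highest, and
   gains there at least what the final forced round costs it. *)
Lemma forced_merge k delta (Ls : seq 'I_n) (Y : seq (alloc * vec)) : par k = k ->
  (size Ls < size Y)%nat -> List.Forall (fun p => forcible k delta p.1 p.2) Y ->
  exists A y, [/\ mergeable (map fst Y) A, fair r par A, A k r + delta <= A r r,
    exists2 p, List.In p Y & p.2 = y &
    forall u, A (par u) u <= A u u \/ [/\ u \notin Ls, par u = k & A k u <= A u u + y u]].
Proof.
move=> kk; elim: Ls Y => [|l Ls IH] Y.
  (* With no leaf left to reserve a round, the first remaining round is the forced one and the
     others are relabeled contentedly. *)
  case: Y => [//|p Y] _ H; inversion H as [|? ? [fp [F [gF dF cF yF]] _] HY]; subst.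
  have [|A [mA fA cA]] := @content_merge (map fst Y).
    by elim: HY => //= q Y' [fq _ _] _ IH; constructor.
  exists (alloc_add (relabel p.1 F) A), p.2; split.
  - by rewrite /= -cat1s; apply: mergeable_cat => //; apply: mergeable1.
  - by apply: fair_add => //; apply: fair_relabel.
  - rewrite /alloc_add /vadd /relabel (group_preserving_root par_root par_eq_root gF).
    by have := fair_root fA k; lra.
  - by exists p; [left|].
  - move=> u; rewrite /alloc_add /vadd /relabel; have := cA u.
    case: (eqVneq (par u) k) => [e|/eqP ne] h.
      by right; split=> //; have := yF u e; rewrite e in h; lra.
    by left; have := cF u ne; lra.
move=> ltY HY.
have [|s1 [p [s2 [eY maxp]]]] := @list_argmax _ (fun p : alloc * vec => p.2 l) Y.
  by move=> e; rewrite e in ltY.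
subst Y; have /List.Forall_app [H1 H2] := HY; inversion H2 as [|? ? [fp _ Mp] H3]; subst.
have [||A [y [mA fA dA [q qY eq] cA]]] := IH (s1 ++ s2).
- by move: ltY; rewrite !size_cat /=; lia.
- by apply/List.Forall_app.
(* The forced round is among those left over, and [p] was the costliest for [l]. *)
have le_y : y l <= p.2 l.
  by rewrite -eq; apply: maxp; have [] := List.in_app_or _ _ _ qY => h;
    apply/List.in_or_app; [left|right; right].
have [a [ga ca gain]] : exists a, [/\ group_preserving par a, leaf_content par (relabel p.1 a) &
    par l = k -> p.2 l <= p.1 (a l) l - p.1 (a k) l].
  case: (eqVneq (par l) k) => [/Mp [M [gM cM gain]]|/eqP ne]; first by exists M.
  by have [a ga ca] := content_relabeling par_idem p.1; exists a; split.
exists (alloc_add (relabel p.1 a) A), y; split.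
- apply: (@mergeable_perm _ (p.1 :: map fst (s1 ++ s2))).
    rewrite !map_cat /=; apply: Permutation_sym; exact: Permutation_middle.
  by rewrite -cat1s; apply: mergeable_cat => //; apply: mergeable1.
- by apply: fair_add => //; apply: fair_relabel.
- have := fair_root (fair_relabel par_root par_eq_root par_idem ga fp) k.
  by rewrite /alloc_add /vadd; lra.
- exists q => //; have [] := List.in_app_or _ _ _ qY => h;
    apply/List.in_or_app; [by left|by right; right].
- move=> u; have := ca u; rewrite /alloc_add /vadd => cu.
  have [h|[uL uk h]] := cA u; first by left; lra.
  (* The gain of [l] in round [p] covers [y l], so [l] ceases to be an exception; other leaves keep
     their status. *)
  case: (eqVneq u l) => [e|ul]; last first.
    by right; rewrite inE negb_or ul; split=> //; rewrite uk in cu; lra.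
  subst u; left; have := gain uk; rewrite uk /relabel; lra.
Qed.

Variable G : rel 'I_n.
Hypothesis edge_par : forall i j, G i j ->
  [\/ par i = j, par j = i, i = r /\ par j = j | j = r /\ par i = i].

Lemma rsum_ge_In (qs : seq vec) q j : (forall q, List.In q qs -> nneg q) -> List.In q qs ->
  q j <= \big[Rplus/0]_(q <- qs) q j.
Proof.
have sum_ge0 (s : seq vec) : (forall q, List.In q s -> nneg q) ->
    0 <= \big[Rplus/0]_(q <- s) q j.
  elim: s => [|q' s IH] h; first by rewrite big_nil; lra.
  rewrite big_cons; have := h q' (or_introl erefl) j.
  by have := IH (fun z zs => h z (or_intror zs)); lra.
elim: qs => //= q0 qs IH ge0; rewrite big_cons => -[->|qin].
  by have := sum_ge0 qs (fun z zs => ge0 z (or_intror zs)); lra.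
have := ge0 q0 (or_introl erefl) j.
by have := IH (fun z zs => ge0 z (or_intror zs)) qin; lra.
Qed.

(** The centre [k] splits [x] equally for its group, and a contented relabeling hands out the parts.
    Of the recipients only [k] can be adjacent to [r], which would not envy it even with all of
    [x]. *)
Lemma win_dominated k (A : alloc) (x : vec) : par k = k -> k != r -> nneg x ->
  fair r par A -> leaf_content par A -> A k r + x r <= A r r ->
  win (final G) n (x :: row A).
Proof.
move=> kk kr x0 fA cA dA.
pose s := filter (fun u => par u == k) (enum 'I_n).
have memS u : (u \in s) = (par u == k) by rewrite mem_filter mem_enum andbT.
have us : uniq s by rewrite filter_uniq ?enum_uniq.
have [m sm] : exists m, size s = m.+1.
  exists (size s).-1; rewrite prednK //; case: (posnP (size s)) => // /size0nil e.
  by have := memS k; rewrite e kk eqxx.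
have mn : (m <= n)%nat.
  by have := count_size (fun u => par u == k) (enum 'I_n); rewrite -size_filter -/s sm size_enum_ord => /ltnW.
apply: (win_le mn); rewrite -[m]addn0.
apply: win_bind (win_split k m (row A) x0) _ => K1 [qs [pK sq Hq Sq]].
(* Agents outside the group have index [size s] and get the default, an empty piece. *)
pose Q : alloc := fun u => nth (fun=> 0) qs (index u s).
have Qout u : par u <> k -> Q u = fun=> 0.
  by move=> /eqP ne; rewrite /Q nth_default // sq -sm leqNgt index_mem memS.
have Qin u : par u = k -> List.In (Q u) qs.
  by move=> e; apply: In_nth; rewrite sq -sm index_mem memS e.
have Q0 u : nneg (Q u).
  case: (eqVneq (par u) k) => [/Qin /Hq []//|/eqP /Qout ->] i; lra.
have Qk u w : par u = par w -> Q u (par w) = Q w (par w).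
  move=> e; case: (eqVneq (par w) k) => [wk|/eqP nw]; last by rewrite !Qout ?e.
  have [_ h1] := Hq _ (Qin _ wk); have [_ h2] := Hq _ (Qin u (etrans e wk)).
  have := lt_0_INR m.+1 (ltP (ltn0Sn m)) => m0.
  by rewrite wk; apply: (Rmult_eq_reg_l (INR m.+1)); lra.
have [a ga ca] := content_relabeling par_idem Q.
pose B := alloc_add (relabel Q a) A.
have ar := group_preserving_root par_root par_eq_root ga.
have w : win (final G) 0 (row B ++ [::]).
  apply: WinDone; exists B; first by rewrite cats0.
  move=> i j /edge_par [pi|pj|[ei pj]|[ej pi]]; rewrite /B /alloc_add /vadd.
  - by have := ca i; have := cA i; rewrite pi; lra.
  - have ii : par i = i by rewrite -pj par_idem.
    have := fair_group fA j; rewrite pj => ->.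
    have := Qk (a j) (a i); rewrite !(group_preservingP _ ga) pj ii /relabel => -> //; lra.
  - subst i; rewrite /relabel ar (Qout r); last by rewrite par_root => e; rewrite e eqxx in kr.
    case: (eqVneq j k) => [->|/eqP jk].
      have ak : par (a k) = k by rewrite (group_preservingP _ ga).
      have := rsum_ge_In r (fun q h => (Hq q h).1) (Qin _ ak).
      by rewrite Sq; lra.
    rewrite (Qout (a j)) ?(group_preservingP _ ga) ?pj //.
    by have := fair_root fA j; lra.
  - subst j; rewrite /relabel ar (Qout r); last by rewrite par_root => e; rewrite e eqxx in kr.
    by have := Q0 (a i) i; have := fair_top fA pi; lra.
apply: WinPerm pK _.
apply: (@win_zeros _ _ (filter (fun u => par u != k) (enum 'I_n))).
apply: (@WinPerm _ _ _ _ (row Q ++ row A)).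
  rewrite catA; apply: Permutation_app_tail; apply: permutation_count => p.
  have qsE : qs = map Q s.
    apply: (@eq_from_nth _ (fun=> 0)); first by rewrite size_map sq sm.
    move=> i; rewrite sq -sm => lt; rewrite (nth_map k) // /Q index_uniq //.
  rewrite count_cat [in X in (_ + X)%nat]qsE.
  have -> : map (fun=> (fun=> 0) : vec) (filter (fun u => par u != k) (enum 'I_n)) =
      map Q (filter (fun u => par u != k) (enum 'I_n)).
    by apply/eq_in_map => u; rewrite mem_filter => /andP [/eqP /Qout -> _].
  rewrite -count_cat -map_cat /row !(count_map Q); apply/seq.permP.
  by rewrite perm_catC; apply/permPl/perm_filterC.
have mQ := @mergeable1 Q a; move: (mQ (final G) 0%nat (row A)); rewrite /rows /= cats0; apply.
by have := win_merge_map (rho := relabel Q a) (rho' := A) w; rewrite cats0.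
Qed.

(** The first [N] rounds supply candidates for forcing. The next [N] shrink the residue until [r]
    values it no more than the loss of any special part found before; the last [n] cuts suffice to
    divide it. *)
Lemma win_final u0 (x : vec) (N := (n * n).+1) : u0 != r -> nneg x ->
  win (final G) (N * (n + n) + (N * (n + n) + n)) [:: x].
Proof.
move=> u0r x0.
apply: win_bind (win_rounds N _ u0r x0) _ => K1 [x1 [H1 [p1 [x10 sH1] fH1 spH1 _]]].
apply: WinPerm p1 _.
apply: win_bind (win_rounds N _ u0r x10) _ => K2 [x2 [H2 [p2 [x20 _] fH2 _ le2]]].
apply: WinPerm p2 _.
have rn1 : 1 <= INR n.
  by apply: (le_INR 1); apply/leP; apply: leq_ltn_trans (ltn_ord r).
(* For [N = n^2 + 1] the factor [(n + N) / n] exceeds [n]. *)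
have {le2} le21 : INR n * x2 r <= x1 r.
  move: le2; rewrite /N S_INR mult_INR => le2; have := x20 r => ge0.
  by apply: (Rmult_le_reg_l (INR n)); nra.
have {spH1} : List.Forall (fun rho => exists k y, (par k = k /\ k != r) /\ forcible k (x2 r) rho y) H1.
  elim: spH1 fH1 {sH1} => [|rho H [s sr le] _ IH] fH1 //.
  inversion fH1 as [|? ? fr fH]; subst; constructor; last exact: IH.
  have [|y fy] := @forcible_exists (x2 r) rho s fr; first nra.
  exists (par s), y; split=> //; split; first exact: par_idem.
  by apply: contra sr => /eqP /par_eq_root ->.
move=> spH1; have [|k [Ha [Hb [pH ltHa]]]] := pigeonhole (m := n) spH1; first by rewrite sH1.
move=> /(Forall_choice (P := fun rho y => (par k = k /\ k != r) /\ forcible k (x2 r) rho y)).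
move=> [Y eHa HY]; subst Ha; rewrite size_map in ltHa.
have [kk kr] : par k = k /\ k != r.
  by case: Y HY ltHa {pH} => [//|p Y] H _; inversion H as [|? ? [] ]; subst.
have {}HY : List.Forall (fun p => forcible k (x2 r) p.1 p.2) Y.
  by apply: List.Forall_impl HY => p [].
(* All agents reserve a round, hence the need for more than [n] rounds with the same [k]; no
   exception remains. *)
have [|A1 [y [m1 f1 d1 _ c1]]] := forced_merge (Ls := enum 'I_n) kk _ HY.
  by rewrite size_enum_ord.
have {}c1 : leaf_content par A1.
  by move=> u; case: (c1 u) => // -[]; rewrite mem_enum.
have [|A1' [m1' f1' c1']] := @content_merge Hb.
  have := Permutation_Forall pH fH1; exact: (fun h => (proj1 (List.Forall_app _ _ _) h).2).
have [A2 [m2 f2 c2]] := content_merge fH2.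
pose A := alloc_add A2 (alloc_add A1 A1').
have mA : mergeable (H2 ++ H1) A.
  by apply: mergeable_cat => //; apply: mergeable_perm pH _; apply: mergeable_cat.
apply: (@WinPerm _ _ _ _ (rows (H2 ++ H1) ++ [:: x2])).
  apply: permutation_count => p.
  by rewrite /= /rows map_cat flatten_cat !count_cat /=; lia.
apply: mA; apply: (@WinPerm _ _ _ _ (x2 :: row A)).
  by apply: Permutation_sym; apply: (Permutation_cons_append (row A)).
apply: (win_dominated kk kr x20).
- by apply: fair_add => //; apply: fair_add.
- by apply: leaf_content_add => //; apply: leaf_content_add.
- have := fair_root f1' k; have := fair_root f2 k.
  by rewrite /A /alloc_add /vadd; lra.
Qed.

End Protocol.

(** * The theorem *)

(** The parent of an agent at distance two is a common neighbour with the root; acyclicity rules out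
    all other kinds of edges. *)
Lemma depth_le2_parent n (G : rel 'I_n) : tree_depth_le2 G ->
  exists (r : 'I_n) (par : 'I_n -> 'I_n),
    [/\ par r = r, forall u, par u = r -> u = r, forall u, par (par u) = par u &
      forall i j, G i j ->
        [\/ par i = j, par j = i, i = r /\ par j = j | j = r /\ par i = i]].
Proof.
move=> [[[Gsym Girr] [_ acyc]] [r depth]].
pose par u := if u == r then r else if G r u then u else odflt r [pick w | G r w && G w u].
have Gneq x y : G x y -> x != y by apply: contraTneq => ->; rewrite Girr.
have parP u : [\/ u = r /\ par u = r, G r u /\ par u = u |
    [/\ u != r, ~~ G r u, G r (par u) & G (par u) u]].
  rewrite /par; case: eqVneq => [->|ur]; first by constructor 1.
  case: (boolP (G r u)) => [ru|nru]; first by constructor 2.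
  constructor 3; case: pickP => [w /andP [rw wu] //|none].
  case: (depth u) => [e|[e|[w [rw wu]]]]; first by rewrite e eqxx in ur.
    by rewrite e in nru.
  by have := none w; rewrite rw wu.
have par_center w : G r w -> par w = w.
  by move=> rw; rewrite /par rw; case: eqP => // e; rewrite e Girr in rw.
(* A second centre adjacent to [j] would close a 4-cycle through [r]. *)
have center_leaf i j : G r i -> G i j -> j != r -> ~~ G r j -> G r (par j) -> G (par j) j ->
    par j = i.
  move=> ri ij jr nrj rw wj; apply/eqP; apply: contraT => ne.
  have ji := Gneq _ _ ij; have wj' := Gneq _ _ wj; have rw' := Gneq _ _ rw.
  have ri' := Gneq _ _ ri.
  have := acyc r [:: i; j; par j]; rewrite /= ri ij Gsym wj [G (par j) r]Gsym rw.
  rewrite !inE !negb_or ri' rw' ji eq_sym jr [i == _]eq_sym ne [j == _]eq_sym wj'.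
  by move=> /(_ isT isT isT).
exists r, par; split.
- by rewrite /par eqxx.
- move=> u; case: (parP u) => [[] //|[_ ->] //|[_ _ + _] e].
  by rewrite e Girr.
- move=> u; case: (parP u) => [[e ->]|[_ e]|[_ _ rw _]]; last exact: par_center.
    by rewrite /par eqxx.
  by rewrite !e.
move=> i j Gij; have Gji : G j i by rewrite Gsym.
have ij := Gneq _ _ Gij.
case: (parP i) => [[ei pi]|[ri pi]|[ir nri rw wi]];
  case: (parP j) => [[ej pj]|[rj pj]|[jr nrj rw' wj]].
- by rewrite ei ej Girr in Gij.
- by constructor 3.
- by rewrite -ei Gij in nrj.
- by constructor 4.
(* Adjacent centres would form a triangle with [r]. *)
- have := acyc r [:: i; j]; rewrite /= ri Gij [G j r]Gsym rj.
  by rewrite !inE !negb_or (Gneq _ _ ri) (Gneq _ _ rj) ij => /(_ isT isT isT).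
- by constructor 2; apply: center_leaf.
- by rewrite -ej Gji in nri.
- by constructor 1; apply: center_leaf.
(* Adjacent leaves would form a triangle with a common centre or a 5-cycle through [r]. *)
- have ni : par i != j by apply: contraNneq nrj => <-.
  have nj : par j != i by apply: contraNneq nri => <-.
  case: (eqVneq (par i) (par j)) => [e|ne].
    have cl : G j (par i) by rewrite e Gsym.
    have := acyc (par i) [:: i; j]; rewrite /= wi Gij cl.
    by rewrite !inE !negb_or (Gneq _ _ wi) ni ij => /(_ isT isT isT).
  have := acyc r [:: par i; i; j; par j].
  rewrite /= rw wi Gij [G j _]Gsym wj [G _ r]Gsym rw'.
  rewrite !inE !negb_or (Gneq _ _ rw) (Gneq _ _ rw') (Gneq _ _ wi) ni ne ij.
  rewrite [r == i]eq_sym ir [r == j]eq_sym jr [i == par j]eq_sym nj [j == par j]eq_sym.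
  by rewrite (Gneq _ _ wj) => /(_ isT isT isT).
Qed.

(** * Counting the queries *)

Lemma INR_cuts n (N := (n * n).+1) : (0 < n)%nat ->
  INR (N * (n + n) + (N * (n + n) + n)) <= 9 * INR n ^ 3.
Proof.
move=> n0; have n1 : 1 <= INR n by apply: (le_INR 1); apply/leP.
have INR_addn a b : INR (a + b)%nat = INR a + INR b := plus_INR a b.
have INR_muln a b : INR (a * b)%nat = INR a * INR b := mult_INR a b.
(* The count is [4 * n^3 + 5 * n], whence the constant 9. *)
rewrite /N !(INR_addn, INR_muln) S_INR INR_muln.
have : INR n <= INR n ^ 3 by rewrite /=; nra.
by rewrite /=; nra.
Qed.

(** As [exp 1 <= 3], from three agents on a logarithmic factor only weakens an upper bound. *)
Lemma ln_ge1 n : (3 <= n)%nat -> 1 <= ln (INR n).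
Proof.
move=> n3; have h : 3 <= INR n by rewrite -[3]/(IZR 3) -(INR_IZR_INZ 3); apply/le_INR/leP.
rewrite -(ln_exp 1); have [lt| ->] : exp 1 < INR n \/ exp 1 = INR n by have := exp_le_3; lra.
  by apply: Rlt_le; apply: ln_increasing => //; apply: exp_pos.
exact: Rle_refl.
Qed.

Theorem theorem3 :
  exists (C : R) (N0 : nat),
    forall (n : nat) (G : rel 'I_n),
      tree_depth_le2 G ->
      exists (P : protocol n) (c e : nat),
        (forall v : 'I_n -> interval_valuation,
            (forall i, is_valuation (v i)) -> succeeds G v P c e) /\
        ((N0 <= n)%nat ->
           INR c <= C * INR n ^ 3 * ln (INR n) /\
           INR e <= C * INR n ^ 4 * ln (INR n)).
Proof.
exists 9, 3%nat => n G tG; have [[_ Girr] _] := tG.1.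
have [r [par [pr per pid edge]]] := depth_le2_parent tG.
(* Without agents there is no root; a single agent takes the whole cake; otherwise some agent
   differs from [r]. *)
move: n G tG Girr r par pr per pid edge => [|[|n]] G tG Girr r par pr per pid edge.
  by have := ltn_ord r.
  have [|P HP] := @win_protocol 1 G 0.
    apply: WinDone; exists (fun _ _ => 1) => [|i j]; last by rewrite !ord1 Girr.
    apply: (@eq_from_nth _ (fun=> 1)); first by rewrite size_map size_enum_ord.
    by case=> // _; rewrite (nth_map ord0) ?size_enum_ord.
  by exists P, 0%nat, (1 * 0)%nat.
have [u0 u0r] : exists u0, u0 != r.
  by case: (eqVneq ord0 r) => [<-|]; [exists ord_max|exists ord0].
have [|P HP] := @win_protocol n.+2 G _ (win_final pr per pid edge u0r _).
  by move=> i; lra.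
set m := (X in forall v, _ -> succeeds G v P X _) in HP.
exists P, m, (n.+2 * m)%nat; split=> // n3.
have ln1 := ln_ge1 n3; have mle : INR m <= 9 * INR n.+2 ^ 3 by apply: INR_cuts.
have n0 := pos_INR n.+2; have n30 := pow_le _ 3 n0.
have cle : INR m <= 9 * INR n.+2 ^ 3 * ln (INR n.+2) by nra.
split=> //; rewrite mult_INR.
have -> : 9 * INR n.+2 ^ 4 * ln (INR n.+2) = INR n.+2 * (9 * INR n.+2 ^ 3 * ln (INR n.+2)).
  by rewrite -[4%nat]/(S 3) -tech_pow_Rmult; ring.
exact: Rmult_le_compat_l.
Qed.
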